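(* There is a normal tiling of the plane $\mathbb{R}^2$ by pairwise non-congruent triangles of unit area.
   Context: A tiling of $\mathbb{R}^2$ is a collection $\{T_1, T_2, \ldots\}$ of compact sets $T_i \subset \mathbb{R}^2$ (the tiles) such that the interiors of distinct tiles are disjoint and the union of all tiles equals $\mathbb{R}^2$. Here the tiles are always simple convex polygons. A tiling is normal if there are real numbers $R > r > 0$ such that (1) each tile contains some ball of radius $r$, and (2) each tile is contained in some ball of radius $R$. *)

(* Defs.v *)
From HB Require Import structures.
From mathcomp Require Import all_boot all_order all_algebra.
From mathcomp Require Import all_classical all_reals all_analysis.

Set Implicit Arguments.
Unset Strict Implicit.
Unset Printing Implicit Defensive.

Import Order.TTheory GRing.Theory Num.Theory numFieldNormedType.Exports.

Local Open Scope classical_set_scope.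
Local Open Scope ring_scope.

(* The plane is [R * R]: its library topology is the product topology, i.e. the
   Euclidean one, but its library norm is the max norm, so the Euclidean
   distance has to be introduced separately. *)
Definition edist (R : realType) (x y : R * R) : R :=
  Num.sqrt ((x.1 - y.1) ^+ 2 + (x.2 - y.2) ^+ 2).

Definition disk (R : realType) (c : R * R) (r : R) : set (R * R) :=
  [set x | edist c x <= r].

Definition area (R : realType) (A : set (R * R)) : \bar R :=
  (@lebesgue_measure R \x @lebesgue_measure R)%E A.

Definition collinear (R : realType) (p q s : R * R) : Prop :=
  exists a b c : R, (a, b) <> (0, 0) /\
    forall x, [\/ x = p, x = q | x = s] -> a * x.1 + b * x.2 = c.

Definition hull3 (R : realType) (p q s : R * R) : set (R * R) :=
  [set x | exists a b c : R, [/\ 0 <= a, 0 <= b, 0 <= c, a + b + c = 1 &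
    x = (a * p.1 + b * q.1 + c * s.1, a * p.2 + b * q.2 + c * s.2)]].

Definition is_triangle (R : realType) (T : set (R * R)) : Prop :=
  exists p q s : R * R, ~ collinear p q s /\ T = hull3 p q s.

(* A distance-preserving map of the plane is automatically bijective;
   reflections are allowed. *)
Definition congruent (R : realType) (A B : set (R * R)) : Prop :=
  exists f : R * R -> R * R,
    (forall x y, edist (f x) (f y) = edist x y) /\ f @` A = B.

Definition is_tiling (R : realType) (C : set (set (R * R))) : Prop :=
  [/\ countable C,
      forall T, C T -> compact T,
      forall S T, C S -> C T -> S <> T -> S° `&` T° = set0 &
      \bigcup_(T in C) T = setT].

Definition is_normal (R : realType) (C : set (set (R * R))) : Prop :=
  exists r rho : R, [/\ 0 < r, r < rho &
    forall T, C T -> (exists c, disk c r `<=` T) /\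
                     (exists c, T `<=` disk c rho)].

(* Main.v *)
Require Import Defs.
From mathcomp Require Import all_boot all_order all_algebra.
From mathcomp Require Import all_classical all_reals all_analysis.
From mathcomp Require Import measurable_realfun zify ring lra.

Set Implicit Arguments.
Unset Strict Implicit.
Unset Printing Implicit Defensive.

Import Order.TTheory GRing.Theory Num.Theory numFieldNormedType.Exports.

Local Open Scope classical_set_scope.
Local Open Scope ring_scope.

(** The plane is cut into the horizontal strips k <= y <= k + 1, and each strip
    into blocks lying between slanted segments, the legs, that join its two
    boundary lines.  The legs are what makes the triangles differ: a shear
    keeps areas, so one family of prototiles, sheared so as to fit legs of
    varying slopes, produces unit triangles of infinitely many shapes, and
    normality only asks that the slopes stay bounded.

    Measure the slope of a leg by its horizontal displacement from bottom to
    top.  Crossing a unit triangle with a side on the boundary of the strip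
    moves one end of the leg by 2, the length of that side.  Such triangles
    alone change the slope by multiples of 2 only, so with bounded slopes they
    must repeat themselves.  An irrational shift comes from a trapezoid with
    vertices A, B, C, D, whose horizontal sides are AB = 5 - sqrt 5 and
    DC = 5 + sqrt 5.  From the point P of the left leg AD at height
    (5 + sqrt 5) / 10 it falls apart into the triangles ABP and PCD of area 1 and
    the triangle PBC of area 3, which is cut into three by trisecting BC.  Such a
    trapezoid shifts the leg by 2 sqrt 5.  It is followed by 2 or 3 triangles with
    apex C and a base of length 2 on the bottom line, which bring the leg back by
    4 or 6.  Their number is the increment of floor (n sqrt 5) at block n, so that
    leg n has slope b + 2 (n sqrt 5 - floor (n sqrt 5)): the slopes are bounded,
    and distinct because sqrt 5 is irrational.  The number b, chosen in [0, 1], is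
    free in each strip.

    Congruent triangles have the same sum of squared sides.  For a tile this sum
    is a quadratic polynomial in b.  Within a strip two such polynomials differ
    ([signature_inj]): the leading coefficient, which is the sum of the squared
    height differences between vertices, separates the prototiles other than
    those of the fan with apex C, and the linear coefficient separates the rest
    by irrationality.  Take b to be a power of x, with a different exponent in
    each strip.  The sums of squared sides then become pairwise different
    polynomials in x ([trinomial_inj]), so that any x in ]0, 1[ outside a
    countable set makes all of them different ([exists_generic_value]).

    That interiors are disjoint is checked by exhibiting separating lines
    ([separated_interior], [proto_separated]), and areas are computed by slicing
    ([area_hull3]).  Since areas are 1 and diameters are bounded, the tiles
    contain disks of a fixed radius ([hull3_contains_disk]). *)

(** * Orientation and barycentric coordinates *)

(** Twice the signed area of the triangle [p q x]. *)
Definition orient (R : realType) (p q x : R * R) : R :=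
  (q.1 - p.1) * (x.2 - p.2) - (q.2 - p.2) * (x.1 - p.1).

Section Triangles.
Variable R : realType.
Implicit Types p q s x y z : R * R.

Lemma orient_rot p q s : orient q s p = orient p q s.
Proof. by rewrite /orient; ring. Qed.

Lemma orient_swap p q s : orient q p s = - orient p q s.
Proof. by rewrite /orient; ring. Qed.

Lemma hull3_rot p q s : hull3 q s p = hull3 p q s.
Proof.
apply/seteqP; split=> x [a [b [c [a0 b0 c0 abc ->]]]].
  by exists c, a, b; split=> //; [lra | congr (_, _); ring].
by exists b, c, a; split=> //; [lra | congr (_, _); ring].
Qed.

Lemma hull3_swap p q s : hull3 q p s = hull3 p q s.
Proof.
apply/seteqP; split=> x [a [b [c [a0 b0 c0 abc ->]]]];
  by exists b, a, c; split=> //; [lra | congr (_, _); ring].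
Qed.

(** The barycentric coordinates of [x] are quotients of orientations; multiplying by
    [orient p q s] instead of dividing makes the criterion insensitive to the
    order of the vertices. *)
Lemma hull3E p q s x : orient p q s != 0 -> hull3 p q s x <->
  [/\ 0 <= orient p q s * orient p q x, 0 <= orient p q s * orient q s x &
      0 <= orient p q s * orient s p x].
Proof.
move=> o0; split=> [[a [b [c [a0 b0 c0 abc ->]]]]|[h1 h2 h3]].
- have {abc}aE : a = 1 - b - c by lra.
  have o2 : 0 <= orient p q s ^+ 2 by exact: sqr_ge0.
  split; [rewrite [leRHS](_ : _ = c * orient p q s ^+ 2) |
          rewrite [leRHS](_ : _ = a * orient p q s ^+ 2) |
          rewrite [leRHS](_ : _ = b * orient p q s ^+ 2)];
    by [exact: mulr_ge0 | rewrite aE /orient /=; ring].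
- have dv w : 0 <= orient p q s * w -> 0 <= w / orient p q s.
    move=> h; rewrite (_ : w / _ = orient p q s * w / orient p q s ^+ 2).
      by rewrite divr_ge0 // sqr_ge0.
    by field.
  exists (orient q s x / orient p q s), (orient s p x / orient p q s),
    (orient p q x / orient p q s); split; rewrite ?dv //.
    rewrite -!mulrDl (_ : _ + _ = orient p q s) ?divff //.
    by rewrite /orient; ring.
  have E (f : R * R -> R) : orient q s x * f p + orient s p x * f q +
      orient p q x * f s = orient p q s * f x ->
    f x = orient q s x / orient p q s * f p + orient s p x / orient p q s * f q +
      orient p q x / orient p q s * f s.
    move=> h; transitivity (orient p q s * f x / orient p q s); first by field.
    by rewrite -h; field.
  by rewrite [LHS]surjective_pairing; congr (_, _); apply: E; rewrite /orient; ring.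
Qed.

Lemma orient_not_collinear p q s : orient p q s != 0 -> ~ collinear p q s.
Proof.
move=> o0 [a [b [c [ab0 h]]]]; apply: ab0.
have hp := h p (Or31 _ _ erefl); have hq := h q (Or32 _ _ erefl).
have hs := h s (Or33 _ _ erefl).
have eq : a * (q.1 - p.1) = - b * (q.2 - p.2) by lra.
have es : a * (s.1 - p.1) = - b * (s.2 - p.2) by lra.
congr (_, _); apply: (mulIf o0); rewrite mul0r.
  transitivity (a * (q.1 - p.1) * (s.2 - p.2) - (q.2 - p.2) * (a * (s.1 - p.1))).
    by rewrite /orient; ring.
  by rewrite eq es; ring.
transitivity (- ((q.1 - p.1) * (- b * (s.2 - p.2)) - - b * (q.2 - p.2) * (s.1 - p.1))).
  by rewrite /orient; ring.
by rewrite -eq -es; ring.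
Qed.

End Triangles.

(** * Area of a triangle *)
Section Area.
Variable R : realType.
Implicit Types p q s : R * R.
Notation mu := (@lebesgue_measure R).

Lemma measurable_affine (k c : R) : measurable_fun setT (fun x : R => k * (x - c)).
Proof. by apply: measurable_funM => //; apply: measurable_funB. Qed.

Lemma integral_affine (k c a b : R) : a <= b ->
  (\int[mu]_(x in `]a, b[) (k * (x - c))%:E =
   (k * (b - c) ^+ 2 / 2 - k * (a - c) ^+ 2 / 2)%:E)%E.
Proof.
rewrite le_eqVlt => /predU1P[->|ab].
  by rewrite set_itvoo0 integral_set0 subrr.
have mk D : measurable_fun D (fun x : R => (k * (x - c))%:E).
  apply/measurable_EFinP; apply: measurable_funTS; exact: measurable_affine.
pose F := fun x : R => k * (x - c) ^+ 2 / 2.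
have dF (x : R) : is_derive x (1 : R) F (k * (x - c)).
  rewrite /F; apply: is_derive_eq.
  by rewrite /GRing.scale /=; field.
rewrite -(@integral_itv_bndoo _ a b _ true false) //.
rewrite (@continuous_FTC2 _ (fun x => k * (x - c)) F) //.
- apply: continuous_subspaceT => x.
  by apply: cvgM; [exact: cvg_cst | apply: cvgB; [exact: cvg_id | exact: cvg_cst]].
- have cF (x : R) : {for x, continuous F}.
    by apply/differentiable_continuous/derivable1_diffP; apply: ex_derive.
  split=> [x _||]; first exact: ex_derive.
  + exact/cvg_at_right_filter/cF.
  + exact/cvg_at_left_filter/cF.
- by move=> x _; rewrite derive1E derive_val.
Qed.

Lemma measurable_hull3 p q s : orient p q s != 0 ->
  measurable (hull3 p q s : set (measurableTypeR R * measurableTypeR R)).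
Proof.
move=> o0.
have mo p' q' : measurable_fun setT
    (fun x : measurableTypeR R * measurableTypeR R =>
      orient p q s * orient p' q' x : R).
  rewrite /orient; apply: measurable_funM => //; apply: measurable_funB.
    by apply: measurable_funM => //; apply: measurable_funB => //;
      exact: measurable_snd.
  by apply: measurable_funM => //; apply: measurable_funB => //;
    exact: measurable_fst.
have mh p' q' : measurable [set x : measurableTypeR R * measurableTypeR R |
    (0 : R) <= orient p q s * orient p' q' x].
  rewrite -[X in measurable X]setTI; apply: measurable_fun_le => //.
rewrite (_ : hull3 p q s =
  [set x | 0 <= orient p q s * orient p q x] `&`
  [set x | 0 <= orient p q s * orient q s x] `&`
  [set x | 0 <= orient p q s * orient s p x]); last first.
  by apply/seteqP; split=> x /=; rewrite hull3E //; case=> // -[].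
by apply: measurableI => //; apply: measurableI.
Qed.

(** The sign [e] treats at once the triangles whose middle vertex is below the long
    side and those where it is above. *)
Lemma mu_between (e f g : R) : e = 1 \/ e = -1 ->
  mu [set y | e * g <= e * y /\ e * y <= e * f] = (Num.max 0 (e * (f - g)))%:E.
Proof.
case=> ->.
  rewrite (_ : [set y | _] = `[g, f]%classic); last first.
    by apply/seteqP; split=> y /=; rewrite !mul1r in_itv /=; [case=> -> -> | move=> /andP[]].
  rewrite lebesgue_measure_itv /= lte_fin mul1r.
  by case: ltP => h; rewrite -?EFinD; congr (_%:E); [rewrite max_r | rewrite max_l]; lra.
rewrite (_ : [set y | _] = `[f, g]%classic); last first.
  apply/seteqP; split=> y /=; rewrite !mulN1r in_itv /= !lerN2;
    [by case=> -> -> | by move=> /andP[]].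
rewrite lebesgue_measure_itv /= lte_fin mulN1r.
by case: ltP => h; rewrite -?EFinD; congr (_%:E); [rewrite max_r | rewrite max_l]; lra.
Qed.

(** The edges [p q] and [p s] bound the vertical slices up to the middle vertex [q], so
    their length grows linearly from [p].  If [p q] is vertical the slices are empty;
    the formula then still holds because a division by zero gives 0. *)
Lemma slice_left p q s (e x : R) : e = 1 \/ e = -1 ->
  orient p q s = e * 2 -> p.1 <= q.1 -> q.1 <= s.1 -> x < q.1 ->
  mu (xsection (hull3 p q s) x) =
  (Num.max 0 (2 / ((q.1 - p.1) * (s.1 - p.1)) * (x - p.1)))%:E.
Proof.
move=> e1 oE pq qs xq.
have e2 : e * e = 1 by case: e1 => ->; ring.
have o0 : orient p q s != 0.
  by rewrite oE; case: e1 => ->; rewrite ?mul1r ?mulN1r ?oppr_eq0 pnatr_eq0.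
have sp : p.1 < s.1.
  rewrite lt_neqAle (le_trans pq qs) andbT; apply: contra o0 => /eqP ps.
  have qp : q.1 = p.1 by lra.
  by apply/eqP; rewrite /orient -ps qp; ring.
have [pq'|pq'] := eqVneq p.1 q.1.
  rewrite pq' subrr mul0r invr0 mulr0 mul0r maxxx.
  rewrite (_ : xsection _ _ = set0) ?measure0 //.
  apply/seteqP; split=> y //; rewrite xsectionE /= hull3E // => -[h _ _].
  move: h o0; rewrite /orient /= -pq' subrr !mul0r !sub0r oppr_eq0 mulf_eq0 => h.
  rewrite negb_or => /andP[q2 _].
  have : 0 < (q.2 - p.2) ^+ 2 * ((s.1 - p.1) * (p.1 - x)).
    apply: mulr_gt0; first by rewrite exprn_even_gt0.
    by apply: mulr_gt0; rewrite subr_gt0 // pq'.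
  by move: h; nra.
have {}pq' : p.1 < q.1 by rewrite lt_neqAle pq'.
have Dq : q.1 - p.1 != 0 by rewrite gt_eqF // subr_gt0.
have Ds : s.1 - p.1 != 0 by rewrite gt_eqF // subr_gt0.
pose L (z : R * R) := p.2 + (z.2 - p.2) * (x - p.1) / (z.1 - p.1).
transitivity (mu [set y | e * L q <= e * y /\ e * y <= e * L s]); last first.
  rewrite mu_between //; congr (Num.max _ _)%:E.
  transitivity (e * (orient p q s / ((q.1 - p.1) * (s.1 - p.1)) * (x - p.1))).
    by rewrite /L /orient; field; rewrite ?Dq ?Ds.
  by rewrite oE -[RHS]mul1r -e2; ring.
have Eq y : orient p q s * orient p q (x, y) =
    2 * (q.1 - p.1) * (e * y - e * L q).
  by rewrite oE /orient /L /=; field; rewrite ?Dq ?Ds.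
have Es y : orient p q s * orient s p (x, y) =
    2 * (s.1 - p.1) * (e * L s - e * y).
  by rewrite oE /orient /L /=; field; rewrite ?Dq ?Ds.
(* The edge [q s] does not bound these slices: its sign condition is a positive
   combination of that of [p q] and of [x <= q.1]. *)
have E3 y : (q.1 - p.1) * (orient p q s * orient q s (x, y)) =
    (s.1 - q.1) * (orient p q s * orient p q (x, y)) +
    orient p q s ^+ 2 * (q.1 - x).
  by rewrite /orient /=; ring.
congr (mu _); apply/seteqP; split=> y; rewrite xsectionE /= hull3E //.
  case=> + _; rewrite Eq Es !pmulr_rge0 ?mulr_gt0 ?subr_gt0 // !subr_ge0.
  by [].
move=> -[h1 h2].
have h3 : 0 <= orient p q s * orient p q (x, y).
  by rewrite Eq pmulr_rge0 ?mulr_gt0 ?subr_gt0 // subr_ge0.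
split=> //; last by rewrite Es pmulr_rge0 ?mulr_gt0 ?subr_gt0 // subr_ge0.
have : 0 <= (q.1 - p.1) * (orient p q s * orient q s (x, y)).
  by rewrite E3 addr_ge0 // mulr_ge0 ?sqr_ge0 // subr_ge0 // ltW.
by rewrite pmulr_rge0 // subr_gt0.
Qed.

Lemma slice_right p q s (e x : R) : e = 1 \/ e = -1 ->
  orient p q s = e * 2 -> p.1 <= q.1 -> q.1 <= s.1 -> q.1 < x ->
  mu (xsection (hull3 p q s) x) =
  (Num.max 0 (2 / ((s.1 - q.1) * (s.1 - p.1)) * (s.1 - x)))%:E.
Proof.
(* Reflection in the vertical axis exchanges the two ends of the triangle. *)
pose r (z : R * R) : R * R := (- z.1, z.2).
move=> e1 oE pq qs xq.
have -> : xsection (hull3 p q s) x = xsection (hull3 (r s) (r q) (r p)) (- x).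
  apply/seteqP; split=> y; rewrite !xsectionE /= => -[a [b [c [a0 b0 c0 abc]]]].
    case=> -> ->; exists c, b, a; split=> //; first by lra.
    by congr (_, _); rewrite /r /=; ring.
  case=> /(congr1 -%R); rewrite opprK => -> ->.
  exists c, b, a; split=> //; first by lra.
  by congr (_, _); rewrite /r /=; ring.
rewrite (@slice_left _ _ _ e) //=; [|rewrite -oE /orient /= ; ring |lra..].
by congr ((Num.max _ (_ / (_ * _) * _))%:E); ring.
Qed.

(** The length of the slices is a tent function vanishing at the two extreme abscissas,
    with a peak of height 2 / (s.1 - p.1) at [q.1], where one of its two ramps may have
    width 0; the slice at [q.1] itself is left out,
    since it may be a whole side. *)
Lemma area_sorted p q s (e : R) : e = 1 \/ e = -1 ->
  orient p q s = e * 2 -> p.1 <= q.1 -> q.1 <= s.1 -> area (hull3 p q s) = 1%E.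
Proof.
move=> e1 oE pq qs.
have o0 : orient p q s != 0.
  by rewrite oE; case: e1 => ->; rewrite ?mul1r ?mulN1r ?oppr_eq0 pnatr_eq0.
have sp : p.1 < s.1.
  rewrite lt_neqAle (le_trans pq qs) andbT; apply: contra o0 => /eqP ps.
  have qp : q.1 = p.1 by lra.
  by apply/eqP; rewrite /orient -ps qp; ring.
rewrite /area /product_measure1.
set F := (F in integral _ _ F).
have mF : measurable_fun setT F.
  by apply: measurable_fun_xsection; exact: measurable_hull3.
have mFD D : measurable_fun D F by exact: measurable_funTS.
rewrite -(@itv_setU_setT _ _ true q.1) ge0_integral_setU //; last first.
  apply/disj_setPS => x /= []; rewrite !in_itv /= andbT.
  by move=> /lt_le_trans h /h; rewrite ltxx.
rewrite -integral_itv_obnd_cbnd; last exact: mFD.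
pose k1 := 2 / ((q.1 - p.1) * (s.1 - p.1)).
pose k2 := 2 / ((s.1 - q.1) * (s.1 - p.1)).
have k1_ge0 : 0 <= k1 by rewrite divr_ge0 // mulr_ge0 // subr_ge0 // ltW.
have k2_ge0 : 0 <= k2 by rewrite divr_ge0 // mulr_ge0 // subr_ge0 // ltW.
have -> : (\int[mu]_(x in `]-oo, q.1[) F x =
   \int[mu]_(x in `]p.1, q.1[) (k1 * (x - p.1))%:E)%E.
  have -> : `]p.1, q.1[%classic = `]-oo, q.1[ `&` `]p.1, +oo[ :> set R.
    by apply/seteqP; split=> x /=; rewrite !in_itv /= andbT; [case/andP | case=> -> ->].
  rewrite integral_mkcondr; apply: eq_integral => x; rewrite inE /= in_itv /= => xq.
  rewrite /F /= (slice_left e1 oE) // -/k1 patchE.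
  case: ifPn; rewrite ?inE ?notin_setE /= in_itv /= andbT => px.
    by rewrite max_r // mulr_ge0 // subr_ge0 ltW.
  by rewrite max_l // mulr_ge0_le0 // subr_le0 leNgt; apply/negP.
have -> : (\int[mu]_(x in `]q.1, +oo[) F x =
   \int[mu]_(x in `]q.1, s.1[) (- k2 * (x - s.1))%:E)%E.
  have -> : `]q.1, s.1[%classic = `]q.1, +oo[ `&` `]-oo, s.1[ :> set R.
    by apply/seteqP; split=> x /=; rewrite !in_itv /= andbT; [case/andP | case=> -> ->].
  rewrite integral_mkcondr; apply: eq_integral => x; rewrite inE /= in_itv /= andbT => xq.
  rewrite /F /= (slice_right e1 oE) // -/k2 patchE.
  case: ifPn; rewrite ?inE ?notin_setE /= in_itv /= => px.
    rewrite max_r; first by congr (_%:E); ring.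
    by apply: mulr_ge0 => //; rewrite subr_ge0 ltW.
  by rewrite max_l // mulr_ge0_le0 // subr_le0 leNgt; apply/negP.
rewrite !integral_affine // !subrr expr0n /= !mulr0 !mul0r subr0 sub0r.
have Ds : s.1 - p.1 != 0 by rewrite gt_eqF // subr_gt0.
have -> : k1 * (q.1 - p.1) ^+ 2 / 2 = (q.1 - p.1) / (s.1 - p.1).
  rewrite /k1; have [->|Dq] := eqVneq (q.1 - p.1) 0.
    by rewrite expr0n /= mulr0 !mul0r.
  by field; rewrite Dq Ds.
have -> : - (- k2 * (q.1 - s.1) ^+ 2 / 2) = (s.1 - q.1) / (s.1 - p.1).
  rewrite /k2 -[q.1 - s.1]opprB; have [->|Dq] := eqVneq (s.1 - q.1) 0.
    by rewrite oppr0 expr0n /= mulr0 !mul0r oppr0.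
  by field; rewrite Dq Ds.
rewrite -EFinD; congr (_%:E).
by field.
Qed.

Lemma area_hull3 p q s : orient p q s = 2 -> area (hull3 p q s) = 1%E.
Proof.
move=> oE.
have {oE} : exists2 e : R, e = 1 \/ e = -1 & orient p q s = e * 2.
  by exists 1; [left | rewrite mul1r].
have sgn e : e = 1 \/ e = -1 -> - e = 1 \/ - e = -1 :> R.
  by case=> ->; rewrite ?opprK; [right | left].
wlog pq : p q s / p.1 <= q.1.
  move=> H [e e1 oE]; have [pq|/ltW pq] := leP p.1 q.1; first by apply: H => //; exists e.
  rewrite -hull3_swap; apply: H => //; exists (- e); first exact: sgn.
  by rewrite orient_swap oE mulNr.
wlog qs : p q s pq / q.1 <= s.1.
  move=> H [e e1 oE]; have [qs|/ltW sq] := leP q.1 s.1; first by apply: H => //; exists e.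
  have [ps|/ltW sp] := leP p.1 s.1.
    rewrite -hull3_swap -hull3_rot; apply: H => //; exists (- e); first exact: sgn.
    by rewrite orient_rot orient_swap oE mulNr.
  rewrite -2!hull3_rot; apply: H => //; exists e => //.
  by rewrite 2!orient_rot.
by case=> e e1 oE; apply: (area_sorted e1 oE).
Qed.

End Area.

(** * The sum of squared sides is a congruence invariant *)
Section Congruence.
Variable R : realType.
Implicit Types p q s x y z : R * R.

Definition sqdist x y : R := (x.1 - y.1) ^+ 2 + (x.2 - y.2) ^+ 2.

Lemma sqdist_ge0 x y : 0 <= sqdist x y.
Proof. by rewrite addr_ge0 // sqr_ge0. Qed.

Lemma sqdistC x y : sqdist x y = sqdist y x.
Proof. by rewrite /sqdist; ring. Qed.

Lemma sqdist_eq0 x y : sqdist x y = 0 -> x = y.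
Proof.
move=> /eqP; rewrite paddr_eq0 ?sqr_ge0 // !sqrf_eq0 !subr_eq0.
by case: x y => [x1 x2] [y1 y2] /= /andP[/eqP -> /eqP ->].
Qed.

Lemma sqdistxx x : sqdist x x = 0.
Proof. by rewrite /sqdist; ring. Qed.

Lemma sqr_edist x y : Defs.edist x y ^+ 2 = sqdist x y.
Proof. by rewrite sqr_sqrtr // sqdist_ge0. Qed.

(** An extreme point, defined through distances alone so that isometries preserve the
    notion without being known to be affine: in the Euclidean plane, [z] is the midpoint
    of [y] and [w] as soon as both its distances to them are half of theirs. *)
Definition extreme (A : set (R * R)) z := A z /\
  forall y w, A y -> A w -> 4 * sqdist z y = sqdist y w ->
    4 * sqdist z w = sqdist y w -> y = w.

(** This is the parallelogram law: the squared length of y + w - 2 z is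
    2 |z - y|^2 + 2 |z - w|^2 - |y - w|^2. *)
Lemma midpoint_of_sqdist z y w :
  4 * sqdist z y = sqdist y w -> 4 * sqdist z w = sqdist y w ->
  y.1 + w.1 = 2 * z.1 /\ y.2 + w.2 = 2 * z.2.
Proof.
move=> h1 h2.
have : (y.1 + w.1 - 2 * z.1) ^+ 2 + (y.2 + w.2 - 2 * z.2) ^+ 2 = 0.
  by move: h1 h2; rewrite /sqdist; lra.
move=> /eqP; rewrite paddr_eq0 ?sqr_ge0 // !sqrf_eq0 => /andP[/eqP ? /eqP ?].
by split; lra.
Qed.

(** The barycentric coordinates at [q] and [s] have their least value 0 at [p], so they
    vanish at both ends of a segment of the triangle with midpoint [p]. *)
Lemma vertex_extreme p q s : orient p q s != 0 -> extreme (hull3 p q s) p.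
Proof.
move=> o0; split.
  exists 1, 0, 0; split=> //; rewrite ?ler01 //; first by ring.
  by case: p {o0} => p1 p2 /=; congr (_, _); ring.
move=> _ _ [a [b [c [a0 b0 c0 abc ->]]]] [a' [b' [c' [a'0 b'0 c'0 abc' ->]]]].
move=> h1 h2; have [{h1 h2}/= e1 e2] := midpoint_of_sqdist h1 h2.
have aE : a = 1 - b - c by lra.
have a'E : a' = 1 - b' - c' by lra.
subst a a'.
have : (b + b') * orient p q s = 0.
  have /= := congr1 ( *%R^~ (s.2 - p.2)) e1.
  by have /= := congr1 ( *%R^~ (s.1 - p.1)) e2; rewrite /orient; lra.
move=> /eqP; rewrite mulf_eq0 (negPf o0) orbF => /eqP hb.
have : (c + c') * orient p q s = 0.
  have /= := congr1 ( *%R^~ (q.2 - p.2)) e1.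
  by have /= := congr1 ( *%R^~ (q.1 - p.1)) e2; rewrite /orient; lra.
move=> /eqP; rewrite mulf_eq0 (negPf o0) orbF => /eqP hc.
have -> : b = 0 by lra.
have -> : b' = 0 by lra.
have -> : c = 0 by lra.
have -> : c' = 0 by lra.
by [].
Qed.

(** A point with two positive barycentric coordinates can be moved both ways in the
    direction [p - q]. *)
Lemma extreme_bary p q s (a b c : R) : p <> q -> 0 <= a -> 0 <= b -> 0 <= c ->
  a + b + c = 1 ->
  extreme (hull3 p q s)
    (a * p.1 + b * q.1 + c * s.1, a * p.2 + b * q.2 + c * s.2) ->
  a = 0 \/ b = 0.
Proof.
move=> pq a0 b0 c0 abc [_ ext].
have [->|an0] := eqVneq a 0; first by left.
have [->|bn0] := eqVneq b 0; first by right.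
pose e := Num.min a b.
have e0 : 0 < e by rewrite lt_min !lt_def an0 bn0 a0 b0.
have ea : e <= a by rewrite ge_min lexx.
have eb : e <= b by rewrite ge_min lexx orbT.
pose pt (d : R) : R * R := ((a + d) * p.1 + (b - d) * q.1 + c * s.1,
                  (a + d) * p.2 + (b - d) * q.2 + c * s.2).
case: pq; have : pt e = pt (- e).
  apply: ext.
  - by exists (a + e), (b - e), c; split=> //; lra.
  - by exists (a - e), (b + e), c; split=> //; [lra..|]; rewrite /pt opprK.
  - by rewrite /sqdist /=; ring.
  - by rewrite /sqdist /=; ring.
move=> [h1 h2]; case: p q h1 h2 {ext pt} => [p1 p2] [q1 q2] /= h1 h2.
congr (_, _); apply/eqP; rewrite -subr_eq0 -(mulrI_eq0 _ (mulfI (lt0r_neq0 e0)));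
  apply/eqP; lra.
Qed.

Lemma extreme_vertex p q s z : orient p q s != 0 ->
  extreme (hull3 p q s) z -> [\/ z = p, z = q | z = s].
Proof.
move=> o0 ez; have [[a [b [c [a0 b0 c0 abc zE]]]] _] := ez; rewrite zE in ez *.
have pq : p <> q by move=> pq; move: o0; rewrite pq /orient !subrr !mul0r subrr eqxx.
have qs : q <> s.
  by move=> qs; move: o0; rewrite -orient_rot qs /orient !subrr !mul0r subrr eqxx.
have sp : s <> p.
  by move=> sp; move: o0; rewrite -2!orient_rot sp /orient !subrr !mul0r subrr eqxx.
have hab := extreme_bary pq a0 b0 c0 abc ez.
have hbc : b = 0 \/ c = 0.
  apply: (extreme_bary (s := p) qs b0 c0 a0); first by lra.
  rewrite hull3_rot; move: ez; congr extreme.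
  by congr (_, _); ring.
have hca : c = 0 \/ a = 0.
  apply: (extreme_bary (s := q) sp c0 a0 b0); first by lra.
  rewrite -hull3_rot; move: ez; congr extreme.
  by congr (_, _); ring.
case: p q s {o0 pq qs sp zE ez} => [p1 p2] [q1 q2] [s1 s2] /=.
case: hab => ?; subst.
  case: hbc => ?; subst.
    have -> : c = 1 by lra.
    by apply: Or33; congr (_, _); ring.
  have -> : b = 1 by lra.
  by apply: Or32; congr (_, _); ring.
case: hca => ?; subst.
  have -> : a = 1 by lra.
  by apply: Or31; congr (_, _); ring.
have -> : c = 1 by lra.
by apply: Or33; congr (_, _); ring.
Qed.

Lemma congruent_extreme (A B : set (R * R)) (f : R * R -> R * R) z :
  (forall x y, sqdist (f x) (f y) = sqdist x y) -> f @` A = B ->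
  extreme A z -> extreme B (f z).
Proof.
move=> fd <- [Az ext]; split; first by exists z.
move=> _ _ [y Ay <-] [w Aw <-]; rewrite !fd => h1 h2.
by congr f; exact: ext.
Qed.

Definition sqperim p q s : R := sqdist p q + sqdist q s + sqdist s p.

(** An isometry sends the extreme points to extreme points, hence the three vertices to
    three distinct vertices, and the sum of squared sides is symmetric in the vertices. *)
Lemma congruent_sqperim p q s p' q' s' :
  orient p q s != 0 -> orient p' q' s' != 0 ->
  congruent (hull3 p q s) (hull3 p' q' s') -> sqperim p q s = sqperim p' q' s'.
Proof.
move=> o0 o0' [f [fE fAB]].
have fd x y : sqdist (f x) (f y) = sqdist x y by rewrite -!sqr_edist fE.
have nz x y : x != y -> 0 != sqdist x y.
  by apply: contra_neq => /esym/sqdist_eq0.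
have pq : 0 != sqdist p q.
  by apply: nz; apply: contra_neq o0 => ->; rewrite /orient; ring.
have qs : 0 != sqdist q s.
  by apply: nz; apply: contra_neq o0 => ->; rewrite /orient; ring.
have sp : 0 != sqdist s p.
  by apply: nz; apply: contra_neq o0 => ->; rewrite /orient; ring.
have vx z : extreme (hull3 p q s) z -> [\/ f z = p', f z = q' | f z = s'].
  by move=> ez; apply: extreme_vertex => //; apply: congruent_extreme fAB ez.
have fp := vx p (vertex_extreme o0).
have fq : [\/ f q = p', f q = q' | f q = s'].
  by apply: vx; rewrite -hull3_rot; apply: vertex_extreme; rewrite orient_rot.
have fs : [\/ f s = p', f s = q' | f s = s'].
  by apply: vx; rewrite -2!hull3_rot; apply: vertex_extreme; rewrite 2!orient_rot.
move: pq qs sp; rewrite /sqperim -(fd p q) -(fd q s) -(fd s p).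
by case: fp => ->; case: fq => ->; case: fs => ->;
  rewrite ?sqdistxx ?eqxx // => _ _ _; rewrite /sqdist; ring.
Qed.

End Congruence.

(** * Compactness, separation and disks *)
Section Topology.
Variable R : realType.
Implicit Types p q s x y z : R * R.

Lemma hull3_compact p q s : compact (hull3 p q s).
Proof.
(* The triangle is the image of the square under a map that collapses one side of the
   square onto [p]. *)
pose f (u : R * R) : R * R :=
  ((1 - u.1) * p.1 + u.1 * ((1 - u.2) * q.1 + u.2 * s.1),
   (1 - u.1) * p.2 + u.1 * ((1 - u.2) * q.2 + u.2 * s.2)).
have -> : hull3 p q s = f @` (`[0, 1] `*` `[0, 1]).
  apply/seteqP; split=> x.
    case=> a [b [c [a0 b0 c0 abc ->]]].
    have [bc0|bc0] := eqVneq (b + c) 0.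
      have -> : a = 1 by lra.
      have -> : b = 0 by lra.
      have -> : c = 0 by lra.
      exists (0, 0); first by split; rewrite /= in_itv /= lexx ler01.
      by rewrite /f /=; congr (_, _); ring.
    have bcp : 0 < b + c by rewrite lt0r bc0 addr_ge0.
    exists (b + c, c / (b + c)).
      split; rewrite /= in_itv /=; first by apply/andP; split; lra.
      apply/andP; split; first by rewrite divr_ge0 // ltW.
      by rewrite ler_pdivrMr // mul1r; lra.
    have -> : a = 1 - (b + c) by lra.
    by rewrite /f /=; congr (_, _); field.
  case=> -[a b] [/=]; rewrite !in_itv /= => /andP[a0 a1] /andP[b0 b1] <-.
  exists (1 - a), (a * (1 - b)), (a * b); split; rewrite ?mulr_ge0 ?subr_ge0 //.
    by ring.
  by rewrite /f /=; congr (_, _); ring.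
apply: continuous_compact; last first.
  by apply: compact_setX; exact: segment_compact.
apply: continuous_subspaceT => u.
have c1 : {for u, continuous (@fst R R)} by exact: cvg_fst.
have c2 : {for u, continuous (@snd R R)} by exact: cvg_snd.
have k (f1 f2 : R * R -> R) : {for u, continuous f1} -> {for u, continuous f2} ->
    {for u, continuous (fun x => (f1 x, f2 x))}.
  by move=> h1 h2; exact: (@cvg_pair _ _ _ _ (nbhs (f1 u)) (nbhs (f2 u))).
have cc (a b c : R) : {for u, continuous (fun x : R * R =>
    (1 - x.1) * a + x.1 * ((1 - x.2) * b + x.2 * c))}.
  apply: cvgD; apply: cvgM; [|exact: cvg_cst|exact: c1|].
    by apply: cvgB; [exact: cvg_cst | exact: c1].
  apply: cvgD; apply: cvgM; [|exact: cvg_cst|exact: c2|exact: cvg_cst].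
  by apply: cvgB; [exact: cvg_cst | exact: c2].
exact: k.
Qed.

Lemma orient_hull3_ge0 p q a b c z : 0 <= orient p q a -> 0 <= orient p q b ->
  0 <= orient p q c -> hull3 a b c z -> 0 <= orient p q z.
Proof.
move=> ha hb hc [l [m [n [l0 m0 n0 lmn ->]]]].
rewrite (_ : orient _ _ _ = l * orient p q a + m * orient p q b + n * orient p q c).
  by rewrite !addr_ge0 // mulr_ge0.
have -> : l = 1 - m - n by lra.
by rewrite /orient /=; ring.
Qed.

(** If an open set lies on both sides of a line, it lies inside the line, which is
    impossible: moving transversally to the line changes the sign of [orient]. *)
Lemma separated_interior p q (S T : set (R * R)) : p <> q ->
  (forall z, S z -> orient p q z <= 0) -> (forall z, T z -> 0 <= orient p q z) ->
  S° `&` T° = set0.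
Proof.
move=> pq hS hT; apply/seteqP; split=> // z [].
rewrite /interior => Sz Tz.
pose n : R * R := (p.2 - q.2, q.1 - p.1).
have o0 : 0 < n.1 ^+ 2 + n.2 ^+ 2.
  rewrite lt0r addr_ge0 ?sqr_ge0 // andbT paddr_eq0 ?sqr_ge0 // !sqrf_eq0 !subr_eq0.
  apply/negP => /andP[/eqP h1 /eqP h2]; apply: pq.
  by rewrite [p]surjective_pairing [q]surjective_pairing h1 h2.
have ct : (fun e : R => (z.1 + e * n.1, z.2 + e * n.2)) @ (0 : R) --> z.
  have : (fun e : R => (z.1 + e * n.1, z.2 + e * n.2)) @ (0 : R) -->
      (z.1 + 0 * n.1, z.2 + 0 * n.2).
    by apply: (@cvg_pair _ _ _ _ (nbhs _) (nbhs _)); apply: cvgD; [exact: cvg_cst|apply: cvgM; [exact: cvg_id|exact: cvg_cst]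
      |exact: cvg_cst|apply: cvgM; [exact: cvg_id|exact: cvg_cst]].
  by rewrite !mul0r !addr0 -surjective_pairing.
have : \forall e \near (0 : R)^'+, (S (z.1 + e * n.1, z.2 + e * n.2)).
  by apply: cvg_within; exact: (ct _ Sz).
have oz : orient p q z = 0.
  by apply/eqP; rewrite eq_le hS ?hT //; exact: nbhs_singleton.
have e0 : \forall e \near (0 : R)^'+, 0 < e by exact: nbhs_right_gt.
move=> eS; have [e [/hS + ep]] := filter_ex (filterI eS e0).
rewrite (_ : orient _ _ _ = orient p q z + e * (n.1 ^+ 2 + n.2 ^+ 2)).
  by rewrite oz add0r leNgt mulr_gt0.
by rewrite /orient /=; ring.
Qed.

(** Cauchy-Schwarz for the determinant of two vectors of lengths at most [D] and [r]. *)
Lemma norm_cross (a b c d D r : R) : 0 <= D -> 0 <= r ->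
  a ^+ 2 + b ^+ 2 <= D ^+ 2 -> c ^+ 2 + d ^+ 2 <= r ^+ 2 -> - (D * r) <= a * d - b * c.
Proof.
move=> D0 r0 h1 h2.
have : (a * d - b * c) ^+ 2 <= (D * r) ^+ 2.
  rewrite exprMn; apply: (@le_trans _ _ ((a ^+ 2 + b ^+ 2) * (c ^+ 2 + d ^+ 2))).
    have := sqr_ge0 (a * c + b * d); lra.
  by apply: ler_pM => //; rewrite addr_ge0 // sqr_ge0.
rewrite -ler_sqrt ?sqr_ge0 // !sqrtr_sqr (ger0_norm (mulr_ge0 D0 r0)).
by rewrite ler_norml => /andP[].
Qed.

(** A disk around the centroid: there, all three orientations are 2 / 3, and moving by
    [r] changes each of them by at most [D * r]. *)
Lemma hull3_contains_disk p q s (D r : R) : orient p q s = 2 -> 0 <= D -> 0 <= r ->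
  D * r <= 2 / 3 -> sqdist p q <= D ^+ 2 -> sqdist q s <= D ^+ 2 ->
  sqdist s p <= D ^+ 2 -> exists c, disk c r `<=` hull3 p q s.
Proof.
move=> o2 D0 r0 Dr hpq hqs hsp.
have o0 : orient p q s != 0 by rewrite o2 pnatr_eq0.
pose c : R * R := ((p.1 + q.1 + s.1) / 3, (p.2 + q.2 + s.2) / 3).
exists c => x; rewrite /disk /= => cx.
have {}cx : sqdist x c <= r ^+ 2.
  by rewrite sqdistC -sqr_edist ler_pXn2r // nnegrE // sqrtr_ge0.
have key a b : sqdist a b <= D ^+ 2 -> orient a b c = 2 / 3 ->
    0 <= orient p q s * orient a b x.
  move=> hab hc; rewrite o2 pmulr_rge0 //.
  rewrite sqdistC /sqdist in hab.
  have := norm_cross D0 r0 hab cx.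
  rewrite (_ : _ * _ - _ = orient a b x - orient a b c); first by rewrite hc; lra.
  by rewrite /orient; ring.
by rewrite hull3E //; split; apply: key => //; rewrite -o2 /c /orient /=; field.
Qed.

Lemma hull3_in_disk p q s (D : R) : 0 <= D ->
  sqdist p q <= D ^+ 2 -> sqdist s p <= D ^+ 2 -> hull3 p q s `<=` disk p D.
Proof.
move=> D0 hq hs _ [a [b [c [a0 b0 c0 abc ->]]]]; rewrite /disk /=.
rewrite -(@ler_pXn2r _ 2) ?nnegrE ?sqrtr_ge0 // sqr_edist.
have aE : a = 1 - b - c by lra.
set A := sqdist p q in hq; set B := sqdist s p in hs.
have hAB : sqdist p (a * p.1 + b * q.1 + c * s.1, a * p.2 + b * q.2 + c * s.2) <=
    (b + c) * (b * A + c * B).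
  (* Stewart's theorem for the cevian from [p], scaled by [b + c]. *)
  rewrite -subr_ge0 (_ : _ - _ = b * c * sqdist q s).
    by rewrite !mulr_ge0 ?sqdist_ge0.
  by rewrite /A /B /sqdist aE /=; ring.
apply: le_trans hAB _.
have h1 : b * A + c * B <= (b + c) * D ^+ 2.
  by rewrite mulrDl lerD // ler_wpM2l.
have D2 : 0 <= D ^+ 2 by exact: sqr_ge0.
have h2 : (b + c) * D ^+ 2 <= D ^+ 2 by rewrite ler_piMl //; lra.
have h3 : 0 <= b * A + c * B by rewrite addr_ge0 // mulr_ge0 ?sqdist_ge0.
apply: (@le_trans _ _ (b * A + c * B)); first by rewrite ler_piMl //; lra.
exact: le_trans h2.
Qed.

End Topology.

(** * Choosing a generic parameter *)
Section Generic.
Variable R : realType.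

Lemma countable_roots (p : {poly R}) : p != 0 -> countable [set x | root p x].
Proof.
move=> p0; apply: finite_set_countable; apply: contrapT => inf.
have [A sA szA] := @infinite_set_fset _ _ (size p) inf.
have : (size (finmap.enum_fset A) < size p)%N.
  apply: max_poly_roots => //; last exact: finmap.fset_uniq.
  by apply/allP => x xA; exact: sA.
by rewrite ltnNge szA.
Qed.

(** The excluded values form a countable set, which cannot contain ]0, 1[ as it has
    measure zero. *)
Lemma exists_generic_value (I : countType) (P : I -> {poly R}) :
  exists x : R, [/\ 0 < x, x < 1 & forall i j, P i != P j -> (P i).[x] != (P j).[x]].
Proof.
pose B := \bigcup_(ij in [set ij : I * I | P ij.1 != P ij.2])
  [set x | root (P ij.1 - P ij.2) x].
have cB : countable B.
  apply: bigcup_countable => // ij; rewrite /= => ij0.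
  by apply: countable_roots; rewrite subr_eq0.
have : ~ (`]0, 1[%classic `<=` B).
  move=> sB; have c01 : countable (`]0, 1[%classic : set R).
    exact: sub_countable (subset_card_le sB) cB.
  have := countable_lebesgue_measure0 c01.
  rewrite lebesgue_measure_itv /= lte_fin ltr01 oppr0 adde0 => /eqP.
  by rewrite eqe oner_eq0.
move=> /existsNP[x /not_implyP[/=]]; rewrite in_itv /= => /andP[x0 x1] xB.
exists x; split=> // i j ij; apply: contra_notN xB => /eqP e.
by exists (i, j) => //=; rewrite /root !hornerE e subrr.
Qed.

(** Sums of squared sides have this form when the parameter of the strip is a power of the
    variable.  The leading coefficients being non-zero, the degree reveals the exponent. *)
Lemma trinomial_inj (e e' : nat) (y z w y' z' w' : R) : (0 < e)%N -> (0 < e')%N ->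
  y != 0 -> y' != 0 ->
  y *: 'X^(e.*2) + z *: 'X^e + w%:P = y' *: 'X^(e'.*2) + z' *: 'X^e' + w'%:P ->
  [/\ e = e', y = y' & z = z'].
Proof.
wlog ee : e e' y z w y' z' w' / (e <= e')%N.
  move=> H e0 e'0 y0 y'0 E; have [ee|/ltnW ee] := leqP e e'; first exact: (H _ _ y z w y' z' w').
  by have [|||||-> -> ->] := H _ _ y' z' w' y z w ee.
move=> e0 e'0 y0 y'0 E.
have C n : y * (n == e.*2)%:R + z * (n == e)%:R + w * (n == 0)%:R =
    y' * (n == e'.*2)%:R + z' * (n == e')%:R + w' * (n == 0)%:R.
  have := congr1 (fun p : {poly R} => p`_n) E.
  by rewrite !coefE; case: (n == 0)%N; rewrite ?mulr1 ?mulr0.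
have D n : (0 < n)%N -> (n.*2 == 0)%N = false /\ (n.*2 == n)%N = false.
  by case: n => // n _; rewrite doubleS; split=> //; apply/eqP; lia.
have [d1 d2] := D _ e0; have [d1' d2'] := D _ e'0.
have {}ee : e = e'.
  apply/eqP; rewrite eqn_leq ee leqNgt; apply/negP => lt_ee.
  have := C e'.*2; rewrite d1' d2' eqxx.
  have -> : (e'.*2 == e.*2)%N = false by apply/eqP; lia.
  have -> : (e'.*2 == e)%N = false by apply/eqP; lia.
  by rewrite !mulr0 !addr0 mulr1 => /esym/eqP; rewrite (negPf y'0).
subst e'; split=> //.
  by have := C e.*2; rewrite d1 d2 eqxx !mulr0 !addr0 !mulr1.
have := C e; rewrite eq_sym d2 eqxx (gtn_eqF e0) !mulr0 !addr0 !add0r !mulr1.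
by [].
Qed.

End Generic.

(** * The prototiles of a block *)
Section Tiling.
Variable R : realType.

Definition sqrt5 : R := Num.sqrt 5.
Definition bottom_len : R := 5 - sqrt5.
Definition top_len : R := 5 + sqrt5.

Lemma sqrt5_sqr : sqrt5 ^+ 2 = 5.
Proof. by rewrite sqr_sqrtr // ler0n. Qed.

Lemma sqrt5_bounds : 22 / 10 < sqrt5 < 23 / 10.
Proof.
have := sqrt5_sqr; have : 0 <= sqrt5 by exact: sqrtr_ge0.
by move=> h0 h2; apply/andP; split; nra.
Qed.

(** A block before shearing has its left leg AD vertical; [vX] and [vY] trisect BC, and the
    points [vF i], starting at B, are the successive ends of the bases of the fan with
    apex C. *)
Definition vA : R * R := (0, 0).
Definition vD : R * R := (0, 1).
Definition vP : R * R := (0, top_len / 10).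
Definition vB : R * R := (bottom_len, 0).
Definition vC : R * R := (top_len, 1).
Definition vX : R * R := ((2 * bottom_len + top_len) / 3, 1 / 3).
Definition vY : R * R := ((bottom_len + 2 * top_len) / 3, 2 / 3).
Definition vF (i : nat) : R * R := (bottom_len + 2 * i%:R, 0).

Lemma vFS i : vF i.+1 = (bottom_len + 2 * (i%:R + 1), 0).
Proof. by rewrite /vF natr1. Qed.

(** The fan triangles are listed without bound; a given block uses the first few. *)
Definition proto (j : nat) : (R * R) * (R * R) * (R * R) :=
  match j with
  | 0 => (vA, vB, vP)
  | 1 => (vP, vC, vD)
  | 2 => (vP, vB, vX)
  | 3 => (vP, vX, vY)
  | 4 => (vP, vY, vC)
  | i.+4.+1 => (vF i, vF i.+1, vC)
  end.

Definition is_vertex (T : (R * R) * (R * R) * (R * R)) (z : R * R) :=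
  [\/ z = T.1.1, z = T.1.2 | z = T.2].

Ltac unf := rewrite /= ?vFS ?/vA ?/vB ?/vC ?/vD ?/vP ?/vX ?/vY ?/vF
  /orient /bottom_len /top_len /=.

Lemma orient_proto j : orient (proto j).1.1 (proto j).1.2 (proto j).2 = 2.
Proof.
have := sqrt5_sqr.
by case: j => [|[|[|[|[|i]]]]]; unf; lra.
Qed.

(** The last inequality is the right leg of a block with [m] fan triangles, which joins
    [vF m] to [vC]. *)
Lemma proto_in_trapezoid (m j : nat) z : (j < 5 + m)%N -> is_vertex (proto j) z ->
  [/\ 0 <= z.2, z.2 <= 1, 0 <= z.1 &
      z.1 <= (bottom_len + 2 * m%:R) * (1 - z.2) + top_len * z.2].
Proof.
move=> jm; have /andP[r1 r2] := sqrt5_bounds; have m0 : 0 <= m%:R :> R by exact: ler0n.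
case: j jm => [|[|[|[|[|i]]]]] jm [] ->; unf; try by split; nra.
- have : 0 <= i%:R :> R by exact: ler0n.
  have : i%:R <= m%:R :> R by rewrite ler_nat; lia.
  by split; nra.
- have : 0 <= i%:R :> R by exact: ler0n.
  have : i%:R + 1 <= m%:R :> R by rewrite natr1 ler_nat; lia.
  by split; nra.
Qed.

(** Every separating line carries a side of one of the prototiles: PB cuts off ABP, then PC
    cuts off PCD, then BC detaches the fan, and the rest is cut by lines through P and
    through C. *)
Lemma proto_separated (j j' : nat) : (j < j')%N -> exists p q : R * R,
  [/\ p <> q, forall z, is_vertex (proto j) z -> orient p q z <= 0 &
      forall z, is_vertex (proto j') z -> 0 <= orient p q z].
Proof.
have /andP[r1 r2] := sqrt5_bounds; have r3 := sqrt5_sqr.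
case: j => [|[|[|[|[|i]]]]] jj'.
- exists vP, vB; split=> [[]|z []->|z]; unf; try lra.
  case: j' jj' => [|[|[|[|[|i]]]]] // _ [] ->; unf; try lra.
    have : 0 <= i%:R :> R by exact: ler0n.
    by nra.
  have : 0 <= i%:R :> R by exact: ler0n.
  by nra.
- exists vC, vP; split=> [[]|z []->|z]; unf; try lra.
  case: j' jj' => [|[|[|[|[|i]]]]] // _ [] ->; unf; try lra.
    have : 0 <= i%:R :> R by exact: ler0n.
    by nra.
  have : 0 <= i%:R :> R by exact: ler0n.
  by nra.
- case: j' jj' => [|[|[|[|[|i]]]]] // _.
  + by exists vP, vX; split=> [[]|z []->|z [] ->]; unf; lra.
  + by exists vP, vX; split=> [[]|z []->|z [] ->]; unf; lra.
  + have i0 : 0 <= i%:R :> R by exact: ler0n.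
    by exists vC, vB; split=> [[]|z []->|z [] ->]; unf; lra.
- case: j' jj' => [|[|[|[|[|i]]]]] // _.
  + by exists vP, vY; split=> [[]|z []->|z [] ->]; unf; lra.
  + have i0 : 0 <= i%:R :> R by exact: ler0n.
    by exists vC, vB; split=> [[]|z []->|z [] ->]; unf; lra.
- case: j' jj' => [|[|[|[|[|i]]]]] // _.
  have i0 : 0 <= i%:R :> R by exact: ler0n.
  by exists vC, vB; split=> [[]|z []->|z [] ->]; unf; lra.
- case: j' jj' => [|[|[|[|[|i']]]]] // ii'.
  have : i.+1%:R <= i'%:R :> R by rewrite ler_nat; lia.
  by rewrite -natr1 => h; exists vC, (vF i'); split=> [[]|z []->|z [] ->]; unf; lra.
Qed.

Lemma fan_cover (m : nat) z :
  orient (vF 0) vC z < 0 -> 0 <= orient (vF m) vC z ->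
  exists2 i, (i < m)%N & orient (vF i) vC z <= 0 /\ 0 <= orient (vF i.+1) vC z.
Proof.
move=> h0; elim: m => [|m IH]; first by rewrite leNgt h0.
have [/IH[i im hi] _|/ltW h hm] := leP 0 (orient (vF m) vC z).
  by exists i => //; exact: ltnW.
by exists m.
Qed.

(** The successive cuts of [proto_separated] locate the point; every side of a prototile
    lies on one of the lines already compared with it, or on the boundary of the block. *)
Lemma proto_cover (m : nat) (z : R * R) : 0 <= z.2 -> z.2 <= 1 -> 0 <= z.1 ->
  z.1 <= (bottom_len + 2 * m%:R) * (1 - z.2) + top_len * z.2 ->
  exists2 j, (j < 5 + m)%N & hull3 (proto j).1.1 (proto j).1.2 (proto j).2 z.
Proof.
have /andP[r1 r2] := sqrt5_bounds; have r3 := sqrt5_sqr.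
move=> y0 y1 x0 xm.
have H j : (j < 5 + m)%N -> 0 <= orient (proto j).1.1 (proto j).1.2 z ->
    0 <= orient (proto j).1.2 (proto j).2 z ->
    0 <= orient (proto j).2 (proto j).1.1 z ->
    exists2 j, (j < 5 + m)%N & hull3 (proto j).1.1 (proto j).1.2 (proto j).2 z.
  move=> jm h1 h2 h3; exists j => //.
  by rewrite hull3E ?orient_proto ?pnatr_eq0 // !pmulr_rge0.
have [h1|/ltW h1] := leP (orient vP vB z) 0.
  by apply: (H 0%N) => //=; move: h1; unf; nra.
have [h2|/ltW h2] := leP (orient vC vP z) 0.
  by apply: (H 1%N) => //=; move: h2; unf; nra.
have [h3|h3] := leP 0 (orient (vF 0) vC z).
  have [h4|/ltW h4] := leP (orient vP vX z) 0.
    by apply: (H 2) => //=; move: h1 h2 h3 h4; unf; lra.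
  have [h5|/ltW h5] := leP (orient vP vY z) 0.
    by apply: (H 3) => //=; move: h1 h2 h3 h4 h5; unf; lra.
  by apply: (H 4) => //=; move: h1 h2 h3 h5; unf; lra.
have hm : 0 <= orient (vF m) vC z by move: xm; unf; lra.
have [i im [h4 h5]] := fan_cover h3 hm.
apply: (H (i.+4.+1)) => //=.
- by unf; lra.
- by move: h4; rewrite /orient /=; lra.
Qed.

(** * The legs of a strip *)

(** If 5 a^2 = b^2 with a nonzero, the exponents of 5 on the two sides have different
    parities. *)
Lemma sqrt5_irrational (a b : int) : sqrt5 * a%:~R = b%:~R -> a = 0.
Proof.
move=> /(congr1 (fun x : R => x ^+ 2)); rewrite exprMn sqrt5_sqr -!rmorphXn /=.
have -> : 5 = (5%:Z)%:~R :> R by [].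
rewrite -rmorphM /= => /intr_inj/(congr1 absz); rewrite abszM !abszX /= => E.
apply/eqP; rewrite -absz_eq0 -leqn0 leqNgt; apply/negP => a0.
have b0 : (0 < `|b|)%N.
  by case: (posnP `|b|) => // b0; move: E; rewrite b0 exp0n //; nia.
have := congr1 (logn 5) E.
by rewrite lognM // ?expn_gt0 ?a0 // !lognX (logn_prime _ (isT : prime 5)) /=; lia.
Qed.

(** [fan_total n] counts the fan triangles of the blocks 0 to n - 1 (with a sign for
    negative n), [fan_size n] those of block n alone.  [corner n] is the abscissa of the
    lower end of leg n, and [lean n] the horizontal displacement along that leg, up to the
    constant of the strip. *)
Definition fan_total (n : int) : int := Num.floor (sqrt5 * n%:~R).
Definition lean (n : int) : R := 2 * (sqrt5 * n%:~R - (fan_total n)%:~R).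
Definition corner (n : int) : R := bottom_len * n%:~R + 2 * (fan_total n)%:~R.
Definition fan_size (n : int) : nat := `|fan_total (n + 1) - fan_total n|%N.

Lemma lean_bounds n : 0 <= lean n < 2.
Proof.
have := floor_le (sqrt5 * n%:~R); have := floorD1_gt (sqrt5 * n%:~R).
by rewrite intrD /lean /fan_total => h1 h2; apply/andP; split; lra.
Qed.

Lemma fan_total_homo n n' : n <= n' -> fan_total n <= fan_total n'.
Proof. by move=> h; apply: le_floor; rewrite ler_wpM2l ?sqrtr_ge0 // ler_int. Qed.

Lemma fan_totalS n : fan_total (n + 1) = fan_total n + (fan_size n)%:Z.
Proof.
have h : fan_total n <= fan_total (n + 1) by apply: fan_total_homo; lia.
by rewrite /fan_size gez0_abs ?subr_ge0 // [RHS]addrC subrK.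
Qed.

Lemma fan_size_le3 n : (fan_size n <= 3)%N.
Proof.
rewrite -(ler_nat R) -[(fan_size n)%:R]/((fan_size n)%:Z%:~R).
have -> : (fan_size n)%:Z = fan_total (n + 1) - fan_total n by rewrite fan_totalS; lia.
have /andP[r1 r2] := sqrt5_bounds.
have := floor_le (sqrt5 * (n + 1)%:~R); have := floorD1_gt (sqrt5 * n%:~R).
rewrite -/(fan_total n) -/(fan_total (n + 1)) intrB => h1 h2.
have {h1 h2} : ((fan_total (n + 1))%:~R - (fan_total n)%:~R : R) < (4%:Z)%:~R.
  by move: h1 h2; rewrite !intrD; lra.
by rewrite -intrB ltr_int => h; rewrite -[3%:R]/(3%:Z%:~R) ler_int; lia.
Qed.

(** Leg n ends at abscissa n (5 + sqrt 5) on the upper line, up to the constant of the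
    strip: the upper ends are equally spaced. *)
Lemma cornerE n : corner n = top_len * n%:~R - lean n.
Proof. by rewrite /corner /lean /bottom_len /top_len; ring. Qed.

Lemma cornerS n : corner (n + 1) = corner n + bottom_len + 2 * (fan_size n)%:R.
Proof. by rewrite /corner fan_totalS !intrD; ring. Qed.

Lemma corner_homo n n' : n <= n' -> corner n <= corner n'.
Proof.
move=> h; have /andP[r1 r2] := sqrt5_bounds.
apply: lerD; rewrite ler_wpM2l ?ler_int ?fan_total_homo //.
by rewrite /bottom_len; lra.
Qed.

(** The terms 2 i record that each fan triangle shifts the leg by 2. *)
Lemma lean_inj (n n' : int) (i i' : nat) :
  lean n - 2 * i%:R = lean n' - 2 * i'%:R -> n = n' /\ i = i'.
Proof.
rewrite /lean => E.
have : sqrt5 * (n - n')%:~R = (fan_total n - fan_total n' + i%:Z - i'%:Z)%:~R.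
  by rewrite !(intrB, intrD) -[i%:Z%:~R]/(i%:R) -[i'%:Z%:~R]/(i'%:R); lra.
move=> /sqrt5_irrational nn'; have {nn'}nn' : n = n' by lia.
subst n'; split=> //; apply/eqP; rewrite -(eqr_nat R); apply/eqP; lra.
Qed.

(** * The tiles *)

(** The prototiles are sheared to match the slope of leg n, then translated to block n of
    strip k; [b] is the constant of the strip.  This map sends the right leg of block n to the
    left leg of block n + 1. *)
Definition place (b : R) (k n : int) (z : R * R) : R * R :=
  (corner n + z.1 + (b + lean n) * z.2, k%:~R + z.2).

Definition tile (b : R) (k n : int) (j : nat) : set (R * R) :=
  hull3 (place b k n (proto j).1.1) (place b k n (proto j).1.2)
    (place b k n (proto j).2).

Lemma orient_place b k n p q z :
  orient (place b k n p) (place b k n q) (place b k n z) = orient p q z.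
Proof. by rewrite /orient /place /=; ring. Qed.

Lemma orient_tile b k n j : orient (place b k n (proto j).1.1)
  (place b k n (proto j).1.2) (place b k n (proto j).2) = 2.
Proof. by rewrite orient_place orient_proto. Qed.

Lemma hull3_place b k n p q s z : hull3 p q s z ->
  hull3 (place b k n p) (place b k n q) (place b k n s) (place b k n z).
Proof.
move=> [c [d [e [c0 d0 e0 cde ->]]]]; exists c, d, e; split=> //.
have -> : c = 1 - d - e by lra.
by rewrite /place /=; congr (_, _); ring.
Qed.

Lemma place_inj b k n : injective (place b k n).
Proof.
move=> [x y] [x' y'] [h1 /addrI h2]; congr (_, _) => //.
by move: h1; rewrite h2 => /addIr/addrI.
Qed.

Lemma tile_separated p q b k n j b' k' n' j' : p <> q ->
  (forall z, is_vertex (proto j) z -> orient p q (place b k n z) <= 0) ->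
  (forall z, is_vertex (proto j') z -> 0 <= orient p q (place b' k' n' z)) ->
  (tile b k n j)° `&` (tile b' k' n' j')° = set0.
Proof.
move=> pq h h'; apply: (separated_interior pq) => z hz.
  rewrite -oppr_ge0 -orient_swap; apply: orient_hull3_ge0 hz;
    by rewrite orient_swap oppr_ge0; apply: h; first [exact: Or31|exact: Or32|exact: Or33].
by apply: orient_hull3_ge0 hz; apply: h'; first [exact: Or31|exact: Or32|exact: Or33].
Qed.

(** With the sides of the triangle written as vectors (dx, dy), these are the sums of
    dy^2 and of dx dy: a shear (x, y) -> (x + b y, y) adds rise b^2 + 2 skew b to the sum of
    squared sides. *)
Definition rise (T : (R * R) * (R * R) * (R * R)) : R :=
  (T.1.1.2 - T.1.2.2) ^+ 2 + (T.1.2.2 - T.2.2) ^+ 2 + (T.2.2 - T.1.1.2) ^+ 2.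
Definition skew (T : (R * R) * (R * R) * (R * R)) : R :=
  (T.1.1.1 - T.1.2.1) * (T.1.1.2 - T.1.2.2) +
  (T.1.2.1 - T.2.1) * (T.1.2.2 - T.2.2) +
  (T.2.1 - T.1.1.1) * (T.2.2 - T.1.1.2).

Lemma sqperim_place b k n p q s : sqperim (place b k n p) (place b k n q) (place b k n s) =
  rise (p, q, s) * b ^+ 2 + 2 * (rise (p, q, s) * lean n + skew (p, q, s)) * b +
  sqperim (place 0 k n p) (place 0 k n q) (place 0 k n s).
Proof. by rewrite /rise /skew /sqperim /sqdist /place /=; ring. Qed.

Lemma rise_neq0 j : rise (proto j) != 0.
Proof.
have /andP[r1 r2] := sqrt5_bounds.
rewrite gt_eqF //; case: j => [|[|[|[|[|i]]]]]; rewrite /rise /= /top_len; nra.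
Qed.

(** The fan triangles all have base 2 and height 1, hence the same [rise]; the
    others have [rise] pairwise different and different from 2. *)
Lemma rise_inj j j' : rise (proto j) = rise (proto j') ->
  j = j' \/ (5 <= j)%N && (5 <= j')%N.
Proof.
have /andP[r1 r2] := sqrt5_bounds; have r3 := sqrt5_sqr.
by case: j => [|[|[|[|[|i]]]]]; case: j' => [|[|[|[|[|i']]]]]; rewrite /rise /= /top_len => E;
  try (by left); try (by right); exfalso; lra.
Qed.

(** For equal [rise] either the prototiles agree and the legs have different leans, or both
    belong to fans, and [skew] is then, up to a constant, minus four times the position in
    the fan: both cases are settled by [lean_inj]. *)
Lemma signature_inj n j n' j' : rise (proto j) = rise (proto j') ->
  rise (proto j) * lean n + skew (proto j) =
  rise (proto j') * lean n' + skew (proto j') -> n = n' /\ j = j'.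
Proof.
move=> Er; case: (rise_inj Er) => [<-|/andP[j5 j5']].
  move=> /addIr/(mulfI (rise_neq0 j)) => h.
  by have [|-> _] := @lean_inj n n' 0 0; rewrite ?h.
case: j j5 Er => [|[|[|[|[|i]]]]] // _ _; case: j' j5' => [|[|[|[|[|i']]]]] // _.
rewrite /rise /skew /= -![i.+1%:R]natr1 -![i'.+1%:R]natr1 /bottom_len /top_len /= => h.
by have [|-> ->] := @lean_inj n n' i i'; last by []; lra.
Qed.

Lemma tile_disjoint_lt_strip (b b' : R) (k k' n n' : int) (j j' : nat) : k < k' ->
  (j < 5 + fan_size n)%N -> (j' < 5 + fan_size n')%N ->
  (tile b k n j)° `&` (tile b' k' n' j')° = set0.
Proof.
move=> kk jn jn'; apply: (@tile_separated (0, k'%:~R) (1, k'%:~R)) => [[/eqP]|z hz|z hz].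
- by rewrite eq_sym oner_eq0.
- have [_ z1 _ _] := proto_in_trapezoid jn hz.
  have : (k + 1)%:~R <= k'%:~R :> R by rewrite ler_int; lia.
  by rewrite intrD /orient /place /=; lra.
- have [z0 _ _ _] := proto_in_trapezoid jn' hz.
  by rewrite /orient /place /=; lra.
Qed.

(** The separating line carries leg n', which no leg to its left crosses inside the strip:
    the legs have their lower ends and their upper ends in the same order. *)
Lemma tile_disjoint_lt_block (b : R) (k n n' : int) (j j' : nat) : n < n' ->
  (j < 5 + fan_size n)%N -> (j' < 5 + fan_size n')%N ->
  (tile b k n j)° `&` (tile b k n' j')° = set0.
Proof.
move=> nn jn jn'.
apply: (@tile_separated (place b k n' (0, 1)) (place b k n' (0, 0))) => [|z hz|z hz].
- by move=> /place_inj[/eqP]; rewrite oner_eq0.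
- have [z0 z1 _ zr] := proto_in_trapezoid jn hz.
  have /andP[r1 r2] := sqrt5_bounds.
  have n1 : n + 1 <= n' by lia.
  have h1 : 0 <= (corner n' - corner (n + 1)) * (1 - z.2).
    by rewrite mulr_ge0 ?subr_ge0 ?corner_homo.
  have h2 : 0 <= (top_len * (n'%:~R - (n + 1)%:~R)) * z.2.
    by rewrite !mulr_ge0 ?subr_ge0 ?ler_int // /top_len; lra.
  move: h1 h2 zr; rewrite cornerS intrD /orient /place /=.
  rewrite (_ : lean n = top_len * n%:~R - corner n); last by rewrite cornerE; ring.
  rewrite (_ : lean n' = top_len * n'%:~R - corner n'); last by rewrite cornerE; ring.
  by lra.
- have [z0 z1 zl _] := proto_in_trapezoid jn' hz.
  by move: zl; rewrite /orient /place /=; lra.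
Qed.

Lemma tile_disjoint_lt (b : R) (k n : int) (j j' : nat) : (j < j')%N ->
  (tile b k n j)° `&` (tile b k n j')° = set0.
Proof.
move=> jj; have [p [q [pq h h']]] := proto_separated jj.
apply: (@tile_separated (place b k n p) (place b k n q)) => [|z /h|z /h'];
  rewrite ?orient_place //.
by move/place_inj.
Qed.

Lemma tile_disjoint (b : int -> R) (k k' n n' : int) (j j' : nat) :
  (j < 5 + fan_size n)%N -> (j' < 5 + fan_size n')%N -> (k, n, j) <> (k', n', j') ->
  (tile (b k) k n j)° `&` (tile (b k') k' n' j')° = set0.
Proof.
move=> jn jn' ne.
case: (ltgtP k k') => [kk|kk|kk]; first exact: tile_disjoint_lt_strip.
  by rewrite setIC; exact: tile_disjoint_lt_strip.
subst k'; case: (ltgtP n n') => [nn|nn|nn]; first exact: tile_disjoint_lt_block.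
  by rewrite setIC; exact: tile_disjoint_lt_block.
subst n'; case: (ltgtP j j') => [jj|jj|jj]; first exact: tile_disjoint_lt.
  by rewrite setIC; exact: tile_disjoint_lt.
by subst j'.
Qed.

(** At a fixed height the abscissas of the legs grow like n (5 + sqrt 5) up to bounded terms,
    so the block containing a point is one of three consecutive ones. *)
Lemma tile_cover (b : int -> R) (z : R * R) : (forall k, 0 <= b k <= 1) ->
  exists k n j, (j < 5 + fan_size n)%N /\ tile (b k) k n j z.
Proof.
move=> b01; have /andP[r1 r2] := sqrt5_bounds.
pose k := Num.floor z.2; pose y := z.2 - k%:~R.
have y0 : 0 <= y by rewrite subr_ge0 floor_le.
have y1 : y < 1 by have := floorD1_gt z.2; rewrite intrD /y /k; lra.
pose leg n := corner n + (b k + lean n) * y.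
have legE n : leg n = top_len * n%:~R - lean n * (1 - y) + b k * y.
  by rewrite /leg cornerE; ring.
have legS n : leg (n + 1) - leg n =
    (bottom_len + 2 * (fan_size n)%:R) * (1 - y) + top_len * y.
  rewrite /leg; have := cornerE n; have := cornerE (n + 1).
  by rewrite cornerS intrD; nra.
have leg_bounds n : top_len * n%:~R - 2 <= leg n <= top_len * n%:~R + 1.
  rewrite legE; have /andP[b0 b1] := b01 k; have /andP[l0 l2] := lean_bounds n.
  by apply/andP; split; nra.
suff [n [l1 l2]] : exists n, leg n <= z.1 /\ z.1 <= leg (n + 1).
  pose w : R * R := (z.1 - leg n, y).
  have [j jn hj] : exists2 j, (j < 5 + fan_size n)%N &
      hull3 (proto j).1.1 (proto j).1.2 (proto j).2 w.
    apply: proto_cover => //=; [exact: ltW | by rewrite subr_ge0 |].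
    by rewrite -legS; lra.
  exists k, n, j; split=> //.
  have := hull3_place (b k) k n hj; rewrite -/(tile _ _ _ _).
  have -> // : place (b k) k n w = z.
  by rewrite [RHS]surjective_pairing /place /w /leg /y /=; congr (_, _); ring.
pose n0 := Num.floor (z.1 / top_len).
have t0 : 0 < top_len by rewrite /top_len; lra.
have lo : top_len * n0%:~R <= z.1.
  by rewrite mulrC -ler_pdivlMr // floor_le.
have hi : z.1 < top_len * (n0 + 1)%:~R.
  by rewrite [ltRHS]mulrC -ltr_pdivrMr // floorD1_gt.
have [h1|/ltW h1] := leP z.1 (leg n0).
  exists (n0 - 1); rewrite subrK; split=> //.
  have /andP[_] := leg_bounds (n0 - 1); rewrite intrB /top_len in lo *; lra.
have [h2|/ltW h2] := leP z.1 (leg (n0 + 1)); first by exists n0.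
exists (n0 + 1); split=> //.
have /andP[+ _] := leg_bounds (n0 + 1 + 1); move: hi; rewrite !intrD /top_len; lra.
Qed.

(** A block has width at most 9, and shearing adds at most 3: the constant of the strip
    contributes 1 and the lean 2. *)
Lemma tile_size (b : R) (k n : int) (j : nat) z w : 0 <= b <= 1 ->
  (j < 5 + fan_size n)%N -> is_vertex (proto j) z -> is_vertex (proto j) w ->
  sqdist (place b k n z) (place b k n w) <= 13 ^+ 2.
Proof.
move=> /andP[b0 b1] jn hz hw; have /andP[r1 r2] := sqrt5_bounds.
have m3 : (fan_size n)%:R <= 3 :> R by rewrite ler_nat fan_size_le3.
have /andP[l0 l2] := lean_bounds n.
have box v : is_vertex (proto j) v -> [/\ 0 <= v.2, v.2 <= 1, 0 <= v.1 & v.1 <= 9].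
  move=> hv; have [v0 v1 v3 v4] := proto_in_trapezoid jn hv; split=> //.
  by move: v4; rewrite /bottom_len /top_len; nra.
have [z0 z1 z2 z3] := box z hz; have [w0 w1 w2 w3] := box w hw.
rewrite (_ : sqdist _ _ =
  (z.1 - w.1 + (b + lean n) * (z.2 - w.2)) ^+ 2 + (z.2 - w.2) ^+ 2); last first.
  by rewrite /sqdist /place /=; ring.
set d := z.2 - w.2; set c := z.1 - w.1; set e := (b + lean n) * d.
have d1 : -1 <= d <= 1 by rewrite /d; apply/andP; split; lra.
have c1 : -9 <= c <= 9 by rewrite /c; apply/andP; split; lra.
have e1 : -3 <= e <= 3.
  by case/andP: d1 => d1 d2; rewrite /e; apply/andP; split; nra.
case/andP: d1 => d1 d2; case/andP: c1 => c1 c2; case/andP: e1 => e1 e2.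
have : (c + e) ^+ 2 <= 144 by nra.
have : d ^+ 2 <= 1 by nra.
lra.
Qed.

End Tiling.

Theorem theorem2 (R : realType) :
  exists C : set (set (R * R)),
    [/\ is_tiling C,
        is_normal C,
        forall T, C T -> is_triangle T,
        forall T, C T -> area T = 1%E &
        forall S T, C S -> C T -> S <> T -> ~ congruent S T].
Proof.
pose I := (int * int * nat)%type.
(* The index (k, n, j) stands for prototile j of block n in strip k; [P i] is the sum of
   squared sides of tile i when the constant of strip k is x ^ (e i). *)
pose e (i : I) := (pickle i.1.1).+1.
pose P (i : I) : {poly R} :=
  rise (proto R i.2) *: 'X^((e i).*2) +
  (2 * (rise (proto R i.2) * lean R i.1.2 + skew (proto R i.2))) *: 'X^(e i) +
  (sqperim (place (0 : R) i.1.1 i.1.2 (proto R i.2).1.1)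
           (place 0 i.1.1 i.1.2 (proto R i.2).1.2)
           (place 0 i.1.1 i.1.2 (proto R i.2).2))%:P.
have P_inj i i' : i <> i' -> P i != P i'.
  move=> ne; apply/eqP => /trinomial_inj[]; rewrite ?rise_neq0 // => ee er es; apply: ne.
  have {}ee : i.1.1 = i'.1.1 by case: ee => /(pcan_inj pickleK).
  have two0 : 2 != 0 :> R by rewrite pnatr_eq0.
  have := signature_inj er (mulfI two0 es).
  by case: i i' {er es} ee => -[k n] j [[k' n'] j'] /= -> [-> ->].
have [x [x0 x1 Px]] := exists_generic_value P.
pose b (k : int) : R := x ^+ (pickle k).+1.
have b01 k : 0 <= b k <= 1.
  by apply/andP; split; [rewrite exprn_ge0 // ltW | rewrite exprn_ile1 // ltW].
have PE i : (P i).[x] = sqperim (place (b i.1.1) i.1.1 i.1.2 (proto R i.2).1.1)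
    (place (b i.1.1) i.1.1 i.1.2 (proto R i.2).1.2)
    (place (b i.1.1) i.1.1 i.1.2 (proto R i.2).2).
  rewrite sqperim_place /P !hornerD !hornerZ !hornerXn hornerC /b /e -muln2 exprM.
  by case: (proto R i.2) => -[].
pose valid := [set i : I | (i.2 < 5 + fan_size R i.1.2)%N].
pose f (i : I) := tile (b i.1.1) i.1.1 i.1.2 i.2.
have o2 k n j : orient (place (b k) k n (proto R j).1.1)
    (place (b k) k n (proto R j).1.2) (place (b k) k n (proto R j).2) != 0.
  by rewrite orient_tile pnatr_eq0.
exists (f @` valid); split.
- split.
  + apply: card_le_trans (card_image_le _ _) _.
    exact: countableP.
  + by move=> _ [i _ <-]; exact: hull3_compact.
  + move=> _ _ [[[k n] j] /= v <-] [[[k' n'] j'] /= v' <-] ne.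
    by apply: tile_disjoint => // -[? ? ?]; apply: ne; subst.
  + apply/seteqP; split=> // z _.
    have [k [n [j [jn hz]]]] := tile_cover z b01.
    by exists (f (k, n, j)) => //; exists (k, n, j).
(* Diameter at most 13 leaves room for a disk of radius (2 / 3) / 13. *)
- exists (2 / 39), 13; split; [lra | lra | ].
  move=> _ [[[k n] j] /= v <-].
  have sz := tile_size k (b01 k) v.
  split.
    apply: (@hull3_contains_disk _ _ _ _ 13); rewrite ?orient_tile //;
      try lra; by apply: sz; first [exact: Or31|exact: Or32|exact: Or33].
  exists (place (b k) k n (proto R j).1.1).
  by apply: hull3_in_disk => //; apply: sz; first [exact: Or31|exact: Or32|exact: Or33].
- move=> _ [[[k n] j] /= v <-].
  exists (place (b k) k n (proto R j).1.1), (place (b k) k n (proto R j).1.2),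
    (place (b k) k n (proto R j).2); split=> //.
  exact: orient_not_collinear.
- by move=> _ [[[k n] j] /= v <-]; apply: area_hull3; exact: orient_tile.
- move=> _ _ [i vi <-] [i' vi' <-] ne /congruent_sqperim; rewrite -!PE => h.
  have := Px i i' (P_inj _ _ _); rewrite h ?o2 // eqxx => h'.
  by have : false by apply: h' => ii; apply: ne; rewrite ii.
Qed.
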